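(* Given $\varepsilon>0$, a $d$-dimensional polytope $P\subset\mathbb{R}^d$ ($d\ge2$) and a contracting reflection law $f$, there exists a constant $\sigma=\sigma(\varepsilon,d,f)>1$ such that for any trajectory $\{(v_j,\eta_j)\}_{j\ge0}$ in $\mathscr{T}_{f,P}$ the following holds. If 1. $P$ is $\varepsilon$-spanning, and 2. $\{(v_j,\eta_j)\}_{j\ge0}$ is $k$-generating, with $k\in\mathbb{N}$, then the linear map $L_{[0,2k]}:v_0^\perp\to v_{2k}^\perp$ satisfies $$\|L_{[0,2k]}(v)\|\ge\sigma\,\|v\|\qquad\text{for all }v\in v_0^\perp .$$
   Context: **Polytopes.** A polytope is a compact finite intersection of closed half-spaces of $\mathbb{R}^d$; its faces are its $(d-1)$-dimensional faces; $\mathscr{N}_P$ is the set of inward unit normals of the faces of $P$. $P$ is $\varepsilon$-spanning if for any $d$ distinct faces with normals $\eta_{i_1},\dots,\eta_{i_d}$ the angle between $\eta_{i_1}$ and the linear span of $\eta_{i_2},\dots,\eta_{i_d}$ (minimum of angles with nonzero vectors of that span) is at least $\varepsilon$. **Notation.** $\mathbb{S}$ is the unit sphere of $\mathbb{R}^d$; $P_\eta(v)=\langle v,\eta\rangle\eta$; $P_{\eta^\perp}(v)=v-\langle v,\eta\rangle\eta$; $R_\eta(v)=v-2\langle v,\eta\rangle\eta$; $P_{v,\eta^\perp}(u)=u-\frac{\langle u,\eta\rangle}{\langle v,\eta\rangle}v$ (projection along $v$ onto $\eta^\perp$). **Contracting reflection law.** A contracting law is a family of $C^2$ maps $C_\eta$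 of $\mathbb{S}^+_\eta=\{v\in\mathbb{S}:\langle v,\eta\rangle>0\}$ into itself, $\eta\in\mathbb{S}$, with: $C_\eta(\eta)=\eta$; $C_\eta=a_\eta P_\eta+b_\eta P_{\eta^\perp}$ for non-negative $C^2$ functions $a_\eta,b_\eta$; $0<\sup\|DC_\eta\|<1$; $O\circ C_\eta=C_{O\eta}\circ O$ for every orthogonal $O$. It is determined by a $C^2$ function $f:[0,\pi/2)\to[0,\pi/2)$ with $f(0)=0$, $0<\sup|f'|<1$ (the contracting reflection law), by $C_\eta(v)=\cos f(\theta)\,\eta+\frac{\sin f(\theta)}{\sin\theta}P_{\eta^\perp}(v)$, $\theta=\arccos\langle v,\eta\rangle$; this extends continuously to $\langle v,\eta\rangle\ge0$ with $f(\pi/2)=\lim_{\theta\to\pi/2}f(\theta)$. **Trajectories.** A sequence $\{(v_j,\eta_j)\}_{j\ge0}\in(\mathbb{S}\times\mathscr{N}_P)^{\mathbb{N}_0}$ is a trajectory if for all $j\ge1$: $\langle v_{j-1},\eta_j\rangle\le0$ and $v_j=C_{\eta_j}(R_{\eta_j}(v_{j-1}))$. $\mathscr{T}_{f,P}$ is the set of trajectories. (Here $\eta_j$ denotes the $j$-th entry of the sequence.) A trajectory is $k$-generating if for every time interval $[i,j]=\{i,\dots,j\}$ with $j-i\ge k$ the normals $\eta_i,\dots,\eta_j$ span $\mathbb{R}^d$. **Velocity tangent flow.** $L_i=P_{v_i^\perp}\circ P_{v_{i-1},\eta_i^\perp}:v_{i-1}^\perp\to v_i^\perp$ and $L_{[i,j]}=L_j\circ\cdots\circ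 L_{i+1}:v_i^\perp\to v_j^\perp$ for $i<j$.
   Formalization: The bound is stated for trajectories with ⟨v_{j-1},η_j⟩ ≠ 0 for j=1,…,2k; trajectories as defined also allow ⟨v_{j-1},η_j⟩ = 0, where the projection along v_{j-1} onto η_j^⊥ divides by zero and L_{[0,2k]} is undefined. *)

(* Defs.v *)
From HB Require Import structures.
From mathcomp Require Import all_boot all_order all_algebra.
From mathcomp Require Import all_classical all_reals all_analysis.

Set Implicit Arguments.
Unset Strict Implicit.
Unset Printing Implicit Defensive.

Import Order.TTheory GRing.Theory Num.Theory.
Import numFieldNormedType.Exports.

Local Open Scope classical_set_scope.
Local Open Scope ring_scope.

Section Euclidean.
Context {R : realType} {d : nat}.
Implicit Types (u v w x eta : 'rV[R]_d) (A : set 'rV[R]_d).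

Definition dot u v : R := \sum_(i < d) u 0 i * v 0 i.

(* The library norm on 'rV[R]_d is the sup norm, hence this definition. *)
Definition enorm u : R := Num.sqrt (dot u u).

Definition usphere : set 'rV[R]_d := [set u | enorm u = 1].

Definition angle u w : R := acos (dot u w / (enorm u * enorm w)).

(* Over a nonzero subspace the infimum is attained. *)
Definition angle_vspace u (U : {vspace 'rV[R]_d}) : R :=
  inf [set angle u w | w in [set w | w \in U /\ w != 0]].

(* Projections and reflection for a unit vector eta. *)
Definition proj_line eta v : 'rV[R]_d := dot v eta *: eta.
Definition proj_orth eta v : 'rV[R]_d := v - dot v eta *: eta.
Definition refl eta v : 'rV[R]_d := v - (2 * dot v eta) *: eta.

(* Projection along v onto the hyperplane orthogonal to eta; meaningful only
   when dot v eta != 0 (otherwise the quotient is 0 by convention). *)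
Definition proj_along v eta u : 'rV[R]_d := u - (dot u eta / dot v eta) *: v.

(* The affine hull of A is a translate of U. *)
Definition aff_direction A (U : {vspace 'rV[R]_d}) : Prop :=
  (forall x y, A x -> A y -> x - y \in U) /\
  (forall W : {vspace 'rV[R]_d},
      (forall x y, A x -> A y -> x - y \in W) -> (U <= W)%VS).

Definition has_dim A (n : nat) : Prop :=
  A !=set0 /\ exists2 U, aff_direction A U & \dim U = n.

End Euclidean.

Section Polytopes.
Context {R : realType} {d : nat}.
Implicit Types (P F : set 'rV[R]_d) (eta : 'rV[R]_d).

Definition is_polytope P : Prop :=
  compact P /\
  exists (m : nat) (n : 'I_m -> 'rV[R]_d) (c : 'I_m -> R),
    (forall i, n i != 0) /\ P = [set x | forall i, c i <= dot x (n i)].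

(* F is a (d-1)-dimensional face of P with inward unit normal eta. *)
Definition face_normal P F eta : Prop :=
  [/\ usphere eta,
      exists c : R, (forall x, P x -> c <= dot x eta) /\
                    F = P `&` [set x | dot x eta = c]
    & has_dim F d.-1].

Definition normals P : set 'rV[R]_d := [set eta | exists F, face_normal P F eta].

(* The distinguished face is F i, for an arbitrary i: the enumeration of the d
   faces being arbitrary, this is the same as distinguishing the first one. *)
Definition spanning (eps : R) P : Prop :=
  forall (F : 'I_d -> set 'rV[R]_d) (eta : 'I_d -> 'rV[R]_d),
    injective F -> (forall i, face_normal P (F i) (eta i)) ->
    forall i : 'I_d,
      eps <= angle_vspace (eta i) <<[seq eta j | j in predC1 i]>>%VS.

End Polytopes.

Section ReflectionLaw.
Context {R : realType}.
Implicit Types (f g : R -> R) (A : set R).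

(* Derivative relative to A, hence one-sided at an endpoint belonging to A. *)
Definition has_derivative_on A f g : Prop :=
  forall x, A x -> (f y - f x) / (y - x) @[y --> within A x^'] --> g x.

(* Only the restriction of f to [0, pi/2) is relevant. *)
Definition contracting_reflection_law f : Prop :=
  let A : set R := [set t | 0 <= t < pi / 2] in
  [/\ forall t, A t -> A (f t),
      f 0 = 0
    & exists f1 f2 : R -> R,
      [/\ has_derivative_on A f f1,
          has_derivative_on A f1 f2,
          {within A, continuous f2}
        & (0 < ereal_sup [set `|f1 t|%:E | t in A] < 1)%E]].

(* Continuous extension of f to [0, pi/2]. *)
Definition law_ext f (t : R) : R :=
  if t == pi / 2 then lim (f s @[s --> (pi / 2)^'-]) else f t.

(* For v = eta the quotient is 0 / 0 = 0 by convention, and the value is eta. *)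
Definition contract {d : nat} f (eta v : 'rV[R]_d) : 'rV[R]_d :=
  let theta := acos (dot v eta) in
  cos (law_ext f theta) *: eta
  + (sin (law_ext f theta) / sin theta) *: proj_orth eta v.

End ReflectionLaw.

Section Trajectories.
Context {R : realType} {d : nat}.
Implicit Types (v eta : nat -> 'rV[R]_d).

Definition trajectory (f : R -> R) (P : set 'rV[R]_d) v eta : Prop :=
  (forall j, usphere (v j) /\ normals P (eta j)) /\
  (forall j, dot (v j) (eta j.+1) <= 0 /\
             v j.+1 = contract f (eta j.+1) (refl (eta j.+1) (v j))).

Definition generating (k : nat) eta : Prop :=
  forall i j : nat, (i + k <= j)%N ->
    <<[seq eta n | n <- index_iota i j.+1]>>%VS = fullv.

(* L_i, for i >= 1. *)
Definition flow_step v eta (i : nat) (u : 'rV[R]_d) : 'rV[R]_d :=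
  proj_orth (v i) (proj_along (v i.-1) (eta i) u).

(* L_[i,j] = L_j o ... o L_(i+1). *)
Definition flow v eta (i j : nat) (u : 'rV[R]_d) : 'rV[R]_d :=
  foldl (fun w n => flow_step v eta n w) u (index_iota i.+1 j.+1).

(* The projections along v_(n-1) entering L_[i,j] exist, i.e. no collision
   n = i+1, ..., j is tangential. *)
Definition flow_defined v eta (i j : nat) : Prop :=
  forall n : nat, (i < n <= j)%N -> dot (v n.-1) (eta n) != 0.

End Trajectories.

(* Main.v *)
(** A non-tangential collision sends [u], orthogonal to [v], to [u'] with
    [|u'|^2 = |u|^2 + t^2 (1 - phi^2)], where [t = - <u, eta> / <v, eta>] and
    [phi = sin (f theta) / sin theta <= mu < 1].  Hence the norm never decreases,
    and the gain controls [<u, eta>^2], [<u', eta>^2] and the displacement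
    [u' - u] off the line of [eta].  If [s^2] is the total gain, every partial
    displacement is at most [C_m s], with [m] the dimension of the span [E] of
    the normals met: off [E] the velocities contract, so displacements sum
    geometrically; on [E], test the endpoints [u_p] and [u_q] against a basis of
    [E] picked greedily from either end, each of whose members comes after a
    subpath of smaller rank.  The eps-spanning hypothesis bounds the coordinates in
    such a basis uniformly.  Once the normals span the whole space, [u_0] itself
    is at most [C s], which is uniform expansion. *)

Require Import Defs.
From HB Require Import structures.
From mathcomp Require Import all_boot all_order all_algebra.
From mathcomp Require Import all_classical all_reals all_analysis.
From mathcomp Require Import ring lra.
Import Order.TTheory GRing.Theory Num.Theory.
Import numFieldNormedType.Exports.
Local Open Scope classical_set_scope.
Local Open Scope ring_scope.

Set Implicit Arguments.
Unset Strict Implicit.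

(** * Euclidean inner product and orthogonal decomposition *)

Section DotProduct.
Context {R : realType} {d : nat}.
Implicit Types (u v w x y z : 'rV[R]_d) (U : {vspace 'rV[R]_d}).

Lemma dotC u v : dot u v = dot v u.
Proof. by rewrite /dot; apply: eq_bigr => i _; rewrite mulrC. Qed.

Lemma dotDl u v w : dot (u + v) w = dot u w + dot v w.
Proof.
by rewrite /dot -big_split; apply: eq_bigr => i _; rewrite mxE mulrDl.
Qed.

Lemma dotZl a u v : dot (a *: u) v = a * dot u v.
Proof. by rewrite /dot mulr_sumr; apply: eq_bigr => i _; rewrite mxE mulrA. Qed.

Lemma dotNl u v : dot (- u) v = - dot u v.
Proof. by rewrite -scaleN1r dotZl mulN1r. Qed.

Lemma dotBl u v w : dot (u - v) w = dot u w - dot v w.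
Proof. by rewrite dotDl dotNl. Qed.

Lemma dotDr u v w : dot w (u + v) = dot w u + dot w v.
Proof. by rewrite dotC dotDl !(dotC w). Qed.

Lemma dotZr a u v : dot v (a *: u) = a * dot v u.
Proof. by rewrite dotC dotZl dotC. Qed.

Lemma dotNr u v : dot v (- u) = - dot v u.
Proof. by rewrite dotC dotNl dotC. Qed.

Lemma dotBr u v w : dot w (u - v) = dot w u - dot w v.
Proof. by rewrite dotDr dotNr. Qed.

Definition dotE := (dotDl, dotZl, dotNl, dotDr, dotZr, dotNr).

Lemma dot0l u : dot 0 u = 0.
Proof. by rewrite -(scale0r u) dotZl mul0r. Qed.

Lemma dot0r u : dot u 0 = 0.
Proof. by rewrite dotC dot0l. Qed.

Lemma dot_suml n (F : 'I_n -> 'rV[R]_d) x :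
  dot (\sum_i F i) x = \sum_i dot (F i) x.
Proof.
by elim/big_ind2: _ => [|x1 x2 y1 y2 <- <-|//]; rewrite ?dot0l ?dotDl.
Qed.

Lemma dot_ge0 u : 0 <= dot u u.
Proof. by apply: sumr_ge0 => i _; rewrite -expr2 sqr_ge0. Qed.

Lemma dot_eq0 u : (dot u u == 0) = (u == 0).
Proof.
apply/eqP/eqP => [/eqP|->]; last by rewrite dot0l.
rewrite psumr_eq0 => [/allP u0|i _]; last by rewrite -expr2 sqr_ge0.
apply/rowP => i; rewrite mxE; apply/eqP.
by have := u0 i (mem_index_enum i); rewrite mulf_eq0 orbb.
Qed.

Lemma enorm_ge0 u : 0 <= enorm u. Proof. exact: sqrtr_ge0. Qed.

Lemma sqr_enorm u : enorm u ^+ 2 = dot u u.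
Proof. by rewrite sqr_sqrtr ?dot_ge0. Qed.

Lemma enorm_eq0 u : (enorm u == 0) = (u == 0).
Proof. by rewrite -dot_eq0 -sqr_enorm sqrf_eq0. Qed.

Lemma enorm_gt0 u : (0 < enorm u) = (u != 0).
Proof. by rewrite lt_neqAle eq_sym enorm_eq0 enorm_ge0 andbT. Qed.

Lemma enormN u : enorm (- u) = enorm u.
Proof. by rewrite /enorm !dotE opprK. Qed.

Lemma usphereP u : usphere u -> dot u u = 1.
Proof. by rewrite /usphere/= -sqr_enorm => ->; rewrite expr1n. Qed.

Lemma cauchy_schwarz u v : `|dot u v| <= enorm u * enorm v.
Proof.
rewrite -ler_sqr ?nnegrE ?mulr_ge0 ?enorm_ge0 // exprMn !sqr_enorm.
rewrite -normrX ger0_norm ?sqr_ge0 //.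
have [->|v0] := eqVneq v 0; first by rewrite !dot0r expr0n mulr0.
have vv : 0 < dot v v by rewrite lt_neqAle eq_sym dot_eq0 v0 dot_ge0.
have := dot_ge0 (dot v v *: u - dot u v *: v).
rewrite !dotE (dotC v u) => h.
rewrite -(ler_pM2l vv) -subr_ge0; apply: le_trans h _; rewrite le_eqVlt.
by apply/orP; left; apply/eqP; ring.
Qed.

(** Gram-Schmidt by induction on [\dim U]: both [x] and a vector [b] of [U] are decomposed along a
    complement [W] of the line of [b], and the remainder of [x] is corrected along [e], the part of
    [b] orthogonal to [W]. *)
Lemma orth_decomp U x :
  exists y z, [/\ x = y + z, y \in U & forall w, w \in U -> dot z w = 0].
Proof.
have [n nU] : exists n, \dim U = n by exists (\dim U).
elim: n U nU x => [|n IH] U nU x.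
  move/eqP: nU; rewrite dimv_eq0 => /eqP ->.
  exists 0, x; split; rewrite ?add0r ?mem0v // => w; rewrite memv0 => /eqP ->.
  exact: dot0r.
have [b [b0 bU]] : exists b, b != 0 /\ b \in U.
  exists (vpick U); rewrite vpick0 memv_pick; split=> //.
  by rewrite -dimv_eq0 nU.
have [W [WU Wn]] : exists W, (W + <[b]> = U)%VS /\ \dim W = n.
  exists (U :\: <[b]>)%VS; split.
    by rewrite addv_diff; apply/addv_idPl; rewrite -memvE.
  have := dimv_cap_compl U <[b]>; rewrite nU.
  suff -> : (U :&: <[b]> = <[b]>)%VS by rewrite dim_vline b0 add1n => -[].
  by apply/capv_idPr; rewrite -memvE.
have WsU : (W <= U)%VS by rewrite -WU addvSl.
have [p [e [bE pW eW]]] := IH W Wn b.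
have [y [z [xE yW zW]]] := IH W Wn x.
have eU : e \in U.
  have -> : e = b - p by rewrite bE addrC addKr.
  by rewrite rpredB // (subvP WsU).
have ze w : w \in U -> exists c w', w' \in W /\ w = w' + c *: e.
  rewrite -WU => /memv_addP [w1 w1W [w2 /vlineP [c ->] ->]].
  exists c, (w1 + c *: p); split; first by rewrite rpredD // rpredZ.
  by rewrite bE scalerDr addrA.
have [e0|e0] := eqVneq e 0.
  exists y, z; split=> // [|w /ze [c [w' [w'W ->]]]].
    exact: (subvP WsU).
  by rewrite e0 scaler0 addr0 zW.
exists (y + (dot z e / dot e e) *: e), (z - (dot z e / dot e e) *: e); split.
- by rewrite xE addrACA subrr addr0.
- by rewrite rpredD ?rpredZ // (subvP WsU).
- move=> w /ze [c [w' [w'W ->]]].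
  rewrite !dotE (zW _ w'W) (eW _ w'W).
  by field; rewrite dot_eq0.
Qed.

End DotProduct.

(** * Frames of unit vectors with angles bounded away from zero *)

Section SpreadFrames.
Context {R : realType} {d : nat}.
Implicit Types (e u v w x y z : 'rV[R]_d) (U : {vspace 'rV[R]_d})
  (s X t : seq 'rV[R]_d).

Lemma free_size_le t : free t -> (size t <= d)%N.
Proof.
by move=> /eqP <-; rewrite (leq_trans (dimvS (subvf _)))// dimvf /dim/= mul1n.
Qed.

(** Greedy completion: a vector of [X] is added only when it lies outside the span built so far. *)
Lemma free_extend t X : free t -> exists t',
  [/\ {subset t' <= X}, free (t' ++ t) & (<<X>> <= <<t' ++ t>>)%VS].
Proof.
move=> ft; elim: X => [|x X [t' [t'X ft' st']]].
  by exists [::]; split=> //; rewrite span_nil sub0v.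
have [xin|xnin] := boolP (x \in <<t' ++ t>>%VS).
  exists t'; split=> // [y /t'X|]; first by rewrite inE orbC => ->.
  by rewrite span_cons subv_add -memvE xin.
exists (x :: t'); split.
- by move=> y; rewrite !inE => /predU1P [->|/t'X ->]; rewrite ?eqxx ?orbT.
- by rewrite cat_cons free_cons xnin.
- by rewrite cat_cons !span_cons addvS.
Qed.

(** For unit vectors, an angle-free form of the eps-spanning condition: [kappa] bounds the cosine of
    the angle between a member and the span of the others. *)
Definition spread (kappa : R) t : Prop :=
  forall e, e \in t -> forall w, w \in <<[seq x <- t | x != e]>>%VS ->
    `|dot e w| <= kappa * enorm w.

Lemma spread_sub kappa s t : {subset s <= t} -> spread kappa t ->
  spread kappa s.
Proof.
move=> st ht e es w ws; apply: ht; first exact: st.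
apply: (subvP _ _ ws); apply: sub_span => x.
by rewrite !mem_filter => /andP [-> /st].
Qed.

(** The difference of the two sides is at least [(|c| kappa - |w|) ^+ 2]. *)
Lemma spread_coef kappa (c : R) e w : 0 <= kappa -> dot e e = 1 ->
  `|dot e w| <= kappa * enorm w ->
  (1 - kappa ^+ 2) * c ^+ 2 <= enorm (c *: e + w) ^+ 2.
Proof.
move=> k0 ee h; rewrite sqr_enorm !dotE ee (dotC w e) -sqr_enorm.
have h1 : `|c * dot e w| <= `|c| * (kappa * enorm w).
  by rewrite normrM ler_wpM2l.
have := sqr_ge0 (`|c| * kappa - enorm w).
move: h1; rewrite ler_norml => /andP [h1 _].
have : `|c| ^+ 2 = c ^+ 2 by rewrite real_normK ?num_real.
set a := `|c| in h1 *; set b := enorm w in h1 *.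
move: (dot e w) h1 => q h1 h2 h3; nra.
Qed.

(* The coefficient of e in y is at most |y| / sqrt (1 - kappa ^+ 2) by
   [spread_coef]. *)
Lemma spread_dot kappa t x y (delta : R) :
  0 <= kappa < 1 -> free t -> (forall e, e \in t -> dot e e = 1) ->
  spread kappa t -> y \in <<t>>%VS ->
  0 <= delta -> (forall e, e \in t -> `|dot x e| <= delta) ->
  `|dot x y| <= d%:R / Num.sqrt (1 - kappa ^+ 2) * delta * enorm y.
Proof.
move=> /andP [k0 k1] ft t1 st yt d0 xt.
have r0 : 0 < 1 - kappa ^+ 2 by rewrite subr_gt0 expr_lt1.
set r := Num.sqrt _; have rp : 0 < r by rewrite sqrtr_gt0.
have yE := coord_span (X := in_tuple t) yt.
rewrite {1}yE dotC dot_suml (le_trans (ler_norm_sum _ _ _)) //.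
have term i : `|dot (coord (in_tuple t) i y *: (in_tuple t)`_i) x| <=
    delta / r * enorm y.
  set c := coord _ i y; have it : t`_i \in t by rewrite mem_nth.
  rewrite /= dotZl normrM dotC mulrC.
  have -> : delta / r * enorm y = delta * (enorm y / r) by rewrite mulrAC mulrA.
  apply: ler_pM => //; first exact: xt.
  rewrite ler_pdivlMr // -ler_sqr ?nnegrE ?mulr_ge0 ?enorm_ge0 ?(ltW rp) //.
  rewrite exprMn real_normK ?num_real // sqr_sqrtr ?(ltW r0) // mulrC.
  move: yE; rewrite (bigD1 i) //= => ->; apply: spread_coef => //.
    exact: t1.
  apply: st => //; apply: memv_suml => j ji; apply: memvZ.
  apply: memv_span; rewrite mem_filter mem_nth // andbT.
  by rewrite nth_uniq // free_uniq.
apply: le_trans (ler_sum _ (fun i _ => term i)) _.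
rewrite sumr_const card_ord -[leLHS]mulr_natl.
have -> : d%:R / r * delta * enorm y = d%:R * (delta / r * enorm y) by ring.
apply: ler_wpM2r; last by rewrite ler_nat free_size_le.
by rewrite mulr_ge0 ?enorm_ge0 // divr_ge0 // ltW.
Qed.

Lemma acos_bound (eps : R) : 0 < eps -> exists2 kappa, 0 <= kappa < 1 &
  forall x : R, -1 <= x <= 1 -> eps <= acos x -> x <= kappa.
Proof.
(* The cap at [pi] keeps [m] where [cos] decreases; the maximum with 0 below handles a negative
   cosine. *)
move=> e0; pose m := Num.min eps pi.
have m0 : 0 < m by rewrite lt_min e0 pi_gt0.
have mpi : m <= pi by rewrite ge_min lexx orbT.
exists (Num.max 0 (cos m)).
  rewrite le_max lexx /= gt_max ltr01 -cos0 ltr_cos ?m0 // in_itv /= ?lexx.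
    exact: pi_ge0.
  by rewrite ltW.
move=> x x1 ex; rewrite le_max; apply/orP; right.
have mi : m \in `[0, pi] by rewrite in_itv /= mpi ltW.
have xi : acos x \in `[0, pi] by rewrite in_itv /= acos_ge0 ?acos_lepi.
rewrite -[leLHS]acosK ?in_itv //= leNgt ltr_cos //.
by rewrite -leNgt ge_min ex.
Qed.

Lemma angle_vspace_le u w U : w \in U -> w != 0 -> angle_vspace u U <= angle u w.
Proof.
move=> wU w0; apply: ge_inf; last by exists w.
exists 0 => _ [z [zU z0] <-]; apply: acos_ge0; rewrite -ler_norml.
have [->|u0] := eqVneq u 0; first by rewrite dot0l mul0r normr0.
rewrite normrM normfV (ger0_norm (mulr_ge0 (enorm_ge0 u) (enorm_ge0 z))).
by rewrite ler_pdivrMr ?mulr_gt0 ?enorm_gt0 // mul1r cauchy_schwarz.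
Qed.

End SpreadFrames.

(** * Face normals and the eps-spanning hypothesis *)

Section FaceNormals.
Context {R : realType} {d : nat}.
Implicit Types (e u v w x y z : 'rV[R]_d) (P F : set 'rV[R]_d)
  (b : seq 'rV[R]_d).

Lemma dot_mulmx u v : dot u v = (u *m v^T) 0 0.
Proof. by rewrite mxE /dot; apply: eq_bigr => i _; rewrite mxE. Qed.

Lemma free_pair b e e' : free b -> e \in b -> e' \in b -> e != e' ->
  free [:: e; e'].
Proof.
move=> fb eb e'b ee'.
have := fb; rewrite (perm_free (perm_to_rem eb)) free_cons => /andP [enot _].
rewrite free_cons span_seq1 seq1_free; apply/andP; split.
  apply: contra enot; apply: subvP; rewrite -memvE memv_span //.
  by rewrite mem_rem_uniq ?free_uniq // !inE eq_sym ee'.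
by apply: contraTneq fb => e'0; apply/negP => /free_not0 /(_ e'b); rewrite e'0 eqxx.
Qed.

(** The direction space of the face has dimension [d - 1] and is orthogonal to both normals; if
    these were independent, its direct sum with their plane would have dimension [d + 1]. *)
Lemma face_normal_not_free P F e e' : (2 <= d)%N ->
  face_normal P F e -> face_normal P F e' -> ~~ free [:: e; e'].
Proof.
move=> d2 [_ [c [_ Fc]] [_ [U [_ Umin] Ud]]] [_ [c' [_ Fc']] _].
apply/negP => fe.
pose hyper z := lker (linfun (mulmxr z^T : 'rV[R]_d -> 'rV[R]_1)).
have hyperP z w : (w \in hyper z) = (dot w z == 0).
  rewrite memv_ker lfunE /= dot_mulmx; apply/eqP/eqP => [->|h]; rewrite ?mxE //.
  by apply/matrixP => i j; rewrite !ord1 h mxE.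
have UW : (U <= hyper e :&: hyper e')%VS.
  apply: Umin => x y Fx Fy; rewrite memv_cap !hyperP !dotBl.
  have := Fx; have := Fy; rewrite {1 2}Fc => -[_ /= ->] [_ /= ->].
  have := Fx; have := Fy; rewrite Fc' => -[_ /= ->] [_ /= ->].
  by rewrite !subrr eqxx.
have US : (U :&: <<[:: e; e']>> = 0)%VS.
  apply/eqP; rewrite -subv0; apply/subvP => x; rewrite memv_cap => /andP [xU].
  have := subvP UW _ xU; rewrite memv_cap !hyperP => /andP [/eqP xe /eqP xe'].
  rewrite span_cons span_seq1 => /memv_addP [_ /vlineP [a ->]].
  move=> [_ /vlineP [a' ->] xE]; rewrite memv0 -dot_eq0 {2}xE !dotE xe xe'.
  by rewrite !mulr0 addr0.
have := dimvS (subvf (U + <<[:: e; e']>>)).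
rewrite dimv_disjoint_sum // Ud (eqP fe) dimvf /dim /= mul1n.
by case: d d2 => [|n] // _; rewrite addn2 ltnn.
Qed.

(** The spanning hypothesis is about distinct faces: one face is chosen for each normal in [b], and
    independence of the normals makes the choice injective. *)
Lemma normals_spread P (eps kappa : R) b :
  (2 <= d)%N -> spanning eps P ->
  (forall x : R, -1 <= x <= 1 -> eps <= acos x -> x <= kappa) ->
  free b -> size b = d -> (forall e, e \in b -> normals P e) ->
  spread kappa b.
Proof.
move=> d2 sP hk fb sb bP e eb w wb.
have bn (i : 'I_d) : b`_i \in b by rewrite mem_nth // sb.
have [F FP] := choice (fun i : 'I_d => bP _ (bn i)).
have Finj : injective F.
  move=> i j Fij; apply/eqP; apply: contraT => ij.
  have := FP j; rewrite -Fij => /(face_normal_not_free d2 (FP i)) /negP nf; case: nf.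
  by apply: (free_pair fb); rewrite // nth_uniq ?sb // free_uniq.
have ltb : (index e b < d)%N by rewrite -[ltnRHS]sb index_mem.
pose i := Ordinal ltb; have ie : b`_i = e by rewrite nth_index.
have := sP F (fun i => b`_i) Finj FP i.
set V := (<<_>>)%VS => sV.
have wV : w \in V.
  apply: (subvP _ _ wb); apply: sub_span => x; rewrite mem_filter => /andP [xe xb].
  have ltx : (index x b < d)%N by rewrite -[ltnRHS]sb index_mem.
  apply/fintype.imageP; exists (Ordinal ltx); last by rewrite nth_index.
  by rewrite !inE; apply: contra xe => /eqP [] xi; rewrite -(nth_index 0 xb) xi nth_index.
have [->|w0] := eqVneq w 0; first by rewrite dot0r /enorm dot0r sqrtr0 normr0 mulr0.
have e1 : enorm e = 1.
  by have [G []] := bP e eb.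
(* The angle bounds the cosine only from above; the lower bound comes from applying this to
   [- w]. *)
have half z : z \in V -> z != 0 -> dot e z <= kappa * enorm z.
  move=> zV z0; have := le_trans sV (angle_vspace_le _ zV z0).
  rewrite /angle ie e1 mul1r => le_acos.
  rewrite -ler_pdivrMr ?enorm_gt0 //; apply: hk le_acos.
  rewrite -ler_norml normrM normfV (ger0_norm (enorm_ge0 z)).
  by rewrite ler_pdivrMr ?enorm_gt0 // mul1r -[leRHS]mul1r -e1 cauchy_schwarz.
rewrite ler_norml half // andbT lerNl -dotNr -[enorm w]enormN half ?oppr_eq0 //.
by rewrite rpredN.
Qed.

End FaceNormals.

(** * Uniform contraction of sines by the reflection law *)

Section ReflectionLawBound.
Context {R : realType}.
Implicit Types (f g : R -> R) (t x y : R).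

(** In the interior of [A] the relative derivative is the two-sided one, as the mean value theorem
    requires. *)
Lemma has_derivative_on_is_derive (A : set R) f g x :
  has_derivative_on A f g -> A x -> nbhs x A -> is_derive x 1 f (g x).
Proof.
move=> /(_ x) fg Ax nA.
suff h : (fun h => h^-1 *: ((f \o shift x) (h *: (1 : R)) - f x)) @ 0^' --> g x.
  by apply: DeriveDef; [apply/cvg_ex; exists (g x) | exact: cvg_lim h].
apply/cvgrPdist_le => e e0.
have /cvgrPdist_le /(_ e e0) near1 := fg Ax.
have {}near1 : nbhs x (fun y => y != x -> A y ->
    `|g x - (f y - f x) / (y - x)| <= e) by exact: near1.
have [r /= r0 rP] : nbhs x (fun y =>
    (y != x -> A y -> `|g x - (f y - f x) / (y - x)| <= e) /\ A y).
  exact: filterI.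
rewrite near_withinE; exists r => //= h; rewrite /ball_ /= sub0r normrN => hr h0.
have xh : ball_ Num.norm x r (h + x) by rewrite /ball_ /= opprD addrCA subrr addr0 normrN.
have [H AH] := rP _ xh.
have -> : h *: (1 : R) = h by rewrite /GRing.scale /= mulr1.
have := H _ AH; rewrite addrK /GRing.scale /= (mulrC h^-1); apply.
by rewrite -subr_eq0 addrK.
Qed.

Lemma contraction_le f (f1 : R -> R) (l b : R) :
  has_derivative_on [set t | 0 <= t < b] f f1 ->
  (forall t, 0 <= t < b -> `|f1 t| <= l) -> f 0 = 0 ->
  forall t, 0 <= t < b -> f t <= l * t.
Proof.
move=> fd f1l f0 t /andP [t0 tb].
move: t0; rewrite le_eqVlt => /predU1P [<-|t0]; first by rewrite f0 mulr0.
have b0 : 0 < b by exact: lt_trans tb.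
have fd' x : 0 < x < b -> is_derive x 1 f (f1 x).
  move=> /andP [x0 xb]; apply: has_derivative_on_is_derive fd _ _ => /=.
    by rewrite (ltW x0).
  have : x \in `]0, b[ by rewrite in_itv /= x0 xb.
  move=> /near_in_itvoo; apply: filterS => y /=.
  by rewrite in_itv /= => /andP [/ltW -> ->].
have fc x : 0 < x < b -> {for x, continuous f}.
  by move=> /fd' [dx _]; apply: differentiable_continuous; apply/derivable1_diffP.
have [||c ct] := @MVT R f f1 0 t t0.
- move=> x; rewrite in_itv /= => /andP [x0 xt]; apply: fd'.
  by rewrite x0 (lt_trans xt).
- apply/continuous_within_itvP => //; split.
  + move=> x; rewrite in_itv /= => /andP [x0 xt]; apply: fc.
    by rewrite x0 (lt_trans xt).
  (* Right continuity at 0: near 0 the difference quotient is within 1 of [f1 0], so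
     [|f y| <= (|f1 0| + 1) y]. *)
  + apply/cvgrPdist_le => e e0.
    have /cvgrPdist_le /(_ 1 ltr01) near1 := fd 0 (introT andP (conj (lexx 0) b0)).
    have {}near1 : nbhs 0 (fun y => y != 0 -> 0 <= y < b ->
        `|f1 0 - (f y - f 0) / (y - 0)| <= 1) by exact: near1.
    have [r /= r0 rP] := near1.
    have M0 : 0 < `|f1 0| + 1 by rewrite ltr_pwDr.
    exists (Num.min (Num.min r b) (e / (`|f1 0| + 1))).
      by rewrite /= !lt_min r0 b0 divr_gt0.
    move=> y /=; rewrite sub0r normrN !lt_min => /andP [/andP [yr yb] ye] y0.
    have yn : `|y| = y by rewrite gtr0_norm.
    have := rP y; rewrite /= sub0r normrN => /(_ yr); rewrite f0 !subr0 gt_eqF //.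
    rewrite (ltW y0) -{1}yn yb => /(_ isT isT) h.
    rewrite sub0r normrN; move: ye; rewrite ltr_pdivlMr // yn => /ltW; apply: le_trans.
    rewrite -[f y](divfK (lt0r_neq0 y0)) normrM yn mulrC ler_pM2l //.
    rewrite -lerBlDl; apply: le_trans (lerB_dist _ _) _.
    by rewrite distrC.
  + by apply: cvg_at_left_filter; apply: fc; rewrite t0.
- rewrite f0 !subr0 => ->; apply: ler_wpM2r; first exact: ltW.
  apply: le_trans (ler_norm _) (f1l _ _).
  by move: ct; rewrite in_itv /= => /andP [/ltW -> /lt_trans]; apply.
Qed.

Lemma le_cos x y : 0 <= x -> x <= y -> y <= pi -> cos y <= cos x.
Proof.
move=> x0 xy yp.
have xi : x \in `[0, pi] by rewrite in_itv /= x0 (le_trans xy).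
have yi : y \in `[0, pi] by rewrite in_itv /= yp (le_trans x0).
by rewrite leNgt ltr_cos // -leNgt.
Qed.

Lemma le_sin x y : - (pi / 2) <= x -> x <= y -> y <= pi / 2 -> sin x <= sin y.
Proof.
move=> x0 xy yp.
have xi : x \in `[- (pi / 2), pi / 2] by rewrite in_itv /= x0 (le_trans xy).
have yi : y \in `[- (pi / 2), pi / 2] by rewrite in_itv /= yp (le_trans x0).
by rewrite leNgt ltr_sin // -leNgt.
Qed.

(** Concavity of sine, read off from the sign of the derivative [r (cos (r x) - cos x)]. *)
Lemma sin_scale_ge (r t : R) : 0 <= r <= 1 -> 0 <= t <= pi ->
  r * sin t <= sin (r * t).
Proof.
move=> /andP [r0 r1] /andP [t0 tp].
pose g (x : R) := sin (r * x) - r * sin x.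
pose dg (x : R) := r * cos (r * x) - r * cos x.
have gd (x : R) : is_derive x 1 g (dg x).
  by rewrite /g /dg; apply: is_derive_eq; rewrite /GRing.scale /=; ring.
have gc : {within `[0, t], continuous g}.
  apply: continuous_subspaceT => x; apply: differentiable_continuous.
  by apply/derivable1_diffP; case: (gd x).
have [c /[!in_itv]/= /andP [c0 ct]] := MVT_segment t0 (fun x _ => gd x) gc.
rewrite /g mulr0 sin0 mulr0 !subr0 => gE; rewrite -subr_ge0 gE.
rewrite mulr_ge0 // /dg -mulrBr mulr_ge0 // subr_ge0 le_cos ?mulr_ge0 //.
  by rewrite ler_piMl.
exact: le_trans tp.
Qed.

(** With [a] and [b] the half sum and half difference of [t] and [l t],
    [sin t - sin (l t) = 2 cos a sin b]. Here [cos a >= kappa > 0] because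
    [a <= (1 + l) pi / 4 < pi / 2], and [sin b >= (1 - l) / 2 sin t]. *)
Lemma sin_contract (l : R) : 0 <= l < 1 -> exists2 mu : R, 0 <= mu < 1 &
  forall t, 0 <= t <= pi / 2 -> sin (l * t) <= mu * sin t.
Proof.
move=> /andP [l0 l1]; have p0 := pi_gt0 R.
pose kappa : R := cos ((1 + l) / 2 * (pi / 2)).
have k0 : 0 < kappa by apply: cos_gt0_pihalf; nra.
have k1 : kappa <= 1 by exact: cos_le1.
exists (1 - kappa * (1 - l)); first by apply/andP; split; nra.
move=> t /andP [t0 tp].
pose a := (1 + l) / 2 * t; pose b := (1 - l) / 2 * t.
have tE : t = a + b by rewrite /a /b; field.
have ltE : l * t = a - b by rewrite /a /b; field.
have sb : (1 - l) / 2 * sin t <= sin b by apply: sin_scale_ge; nra.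
have ca : kappa <= cos a.
  apply: le_cos; rewrite /a; nra.
have st : 0 <= sin t by apply: sin_ge0_pi; nra.
have : sin t - sin (l * t) = 2 * (cos a * sin b).
  by rewrite ltE {1}tE sinB sinD; ring.
have : kappa * ((1 - l) / 2 * sin t) <= cos a * sin b.
  by apply: ler_pM => //; [exact: ltW|rewrite mulr_ge0 //; lra].
nra.
Qed.

(** Since [f t <= l t] with [l = sup |f1| < 1], a single [mu < 1] serves all angles up to grazing
    incidence. *)
Lemma reflection_law_sin_bound f : contracting_reflection_law f ->
  exists2 mu : R, 0 <= mu < 1 &
    forall t, 0 <= t < pi / 2 -> 0 <= sin (f t) <= mu * sin t.
Proof.
move=> [fA f0 [f1 [f2 [f1d _ _ /andP [s0 s1]]]]].
set S := ereal_sup _ in s0 s1.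
have Sfin : S \is a fin_num by rewrite fin_numE gt_eqF ?lt_eqF // ?(lt_trans s1) ?(lt_trans _ s0) ?ltNyr ?ltry.
have SE : S = (fine S)%:E by rewrite fineK.
have l0 : 0 < fine S by rewrite -lte_fin -SE.
have l1 : fine S < 1 by rewrite -lte_fin -SE.
have f1l t : 0 <= t < pi / 2 -> `|f1 t| <= fine S.
  by move=> tA; rewrite -lee_fin -SE; apply: ereal_sup_ubound; exists t.
have [|mu mu01 muP] := @sin_contract (fine S); first by rewrite l1 ltW.
exists mu => // t tA; have p0 := pi_gt0 R.
have /andP [ft0 ftp] := fA t tA.
have fl := contraction_le f1d f1l f0 tA.
move: tA => /andP [t0 tp]; apply/andP; split.
  by apply: sin_ge0_pi; lra.
apply: le_trans (muP t _); last by rewrite t0 ltW.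
by apply: le_sin => //; nra.
Qed.

End ReflectionLawBound.

(** * A single collision *)

Section CollisionStep.
Context {R : realType} {d : nat}.
Implicit Types (u v e : 'rV[R]_d).

(** Reflection alters only the component along [e], so the part of [v] orthogonal to [e] is just
    scaled by [phi]. Strict negativity of [dot v e] keeps the angle below [pi / 2], where
    [law_ext f] is [f]. *)
Lemma contract_refl (f : R -> R) (mu : R) e v :
  (forall t, 0 <= t < pi / 2 -> 0 <= sin (f t) <= mu * sin t) -> 0 <= mu ->
  dot e e = 1 -> dot v v = 1 -> dot v e < 0 ->
  exists g phi : R, [/\ 0 <= phi, phi <= mu &
    Defs.contract f e (refl e v) = g *: e + phi *: v].
Proof.
move=> fmu mu0 ee vv c0.
have cE : dot (refl e v) e = - dot v e by rewrite /refl !dotE ee; ring.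
have c1 : - dot v e <= 1.
  have := cauchy_schwarz v e; rewrite /enorm ee vv !sqrtr1 mulr1.
  by rewrite ler_norml => /andP [h _]; lra.
have cI : -1 <= - dot v e <= 1 by lra.
rewrite /Defs.contract cE; set th := acos (- dot v e); have p0 := pi_gt0 R.
have cth : cos th = - dot v e by rewrite acosK // in_itv /=.
have th0 : 0 <= th by apply: acos_ge0.
have thp : th < pi / 2.
  have thi : th \in `[0, pi] by rewrite in_itv /= th0 acos_lepi.
  have pih : pi / 2 \in `[0, (pi : R)] by rewrite in_itv /=; lra.
  by rewrite -ltr_cos // cos_pihalf cth; lra.
have sth : 0 <= sin th by apply: sin_ge0_pi; lra.
have /andP [sf0 sf1] := fmu th (introT andP (conj th0 thp)).
rewrite /law_ext lt_eqF //; set phi := sin (f th) / sin th.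
exists (cos (f th) - phi * dot v e), phi; split.
- exact: divr_ge0.
(* At normal incidence [sin th = 0] and [phi] is 0 by convention. *)
- rewrite /phi; have [->|s0] := eqVneq (sin th) 0; first by rewrite invr0 mulr0.
  by rewrite ler_pdivrMr // lt_neqAle eq_sym s0.
- rewrite /proj_orth cE /refl; apply/rowP => i; rewrite !mxE; ring.
Qed.

(* With [t = - dot u e / dot v e], the step adds [t ^+ 2] to the square of the
   norm (projection along v) and then removes [(t * phi) ^+ 2] (projection onto
   the orthogonal complement of v'). *)
Lemma flow_step_expand (g phi : R) e v u (v' := g *: e + phi *: v)
    (u' := proj_orth v' (proj_along v e u)) :
  dot e e = 1 -> dot v v = 1 -> dot v' v' = 1 -> 0 <= phi <= 1 ->
  dot v e != 0 -> dot u v = 0 ->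
  exists t a b : R, [/\ dot u' v' = 0,
    dot u' u' = dot u u + t ^+ 2 * (1 - phi ^+ 2),
    u' - u = a *: e + b *: v, b ^+ 2 <= t ^+ 2 * (1 - phi ^+ 2) &
    `|dot u e| <= `|t| /\ `|dot u' e| <= `|t| ].
Proof.
move=> ee vv vv' /andP [p0 p1] c0 uv.
have cs x : dot x x = 1 -> `|dot x e| <= 1.
  by move=> xx; have := cauchy_schwarz x e; rewrite /enorm xx ee sqrtr1 mulr1.
pose t := - (dot u e / dot v e).
have ue : dot u e = - t * dot v e by rewrite /t opprK divfK.
have uE : u' = u + t *: v - (t * phi) *: v'.
  rewrite /u' /proj_orth /proj_along -scaleNr -/t.
  suff -> : dot (u + t *: v) v' = t * phi by [].
  by rewrite /v' !dotE uv vv ue; ring.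
(* The projection [u + t *: v] is orthogonal to [e], so its product with [v'] sees only the term
   [phi *: v]. *)
have we : dot (u + t *: v) e = 0 by rewrite !dotE ue; ring.
have wv' : dot (u + t *: v) v' = t * phi.
  by rewrite /v' dotDr !dotZr we !dotE uv vv; ring.
exists t, (- (t * phi * g)), (t * (1 - phi ^+ 2)); split.
- by rewrite uE dotDl dotNl dotZl wv' vv'; ring.
- rewrite uE [LHS]dotBl !dotBr !(dotZl _ v') !(dotZr _ v') wv' vv'.
  by rewrite (dotC v') wv' !dotE uv (dotC v u) uv vv; ring.
- by rewrite uE /v'; apply/rowP => i; rewrite !mxE; ring.
- rewrite exprMn; apply: ler_wpM2l; first exact: sqr_ge0.
  have : phi ^+ 2 <= 1 by rewrite expr_le1.
  have := sqr_ge0 phi; move: (phi ^+ 2) => q; nra.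
- split.
    by rewrite ue normrM normrN ler_piMr // cs.
  rewrite uE dotBl we sub0r normrN dotZl !normrM -mulrA ler_piMr //.
  by rewrite mulr_ile1 // ?cs // ger0_norm.
Qed.

End CollisionStep.

(** * Spans of consecutive normals and their greedy bases *)

Section TangentPath.
Context {R : realType} {d : nat}.
Implicit Types (x y z : 'rV[R]_d) (U V : {vspace 'rV[R]_d}).

Lemma ltn_dimv U V x : (U <= V)%VS -> x \in V -> x \notin U ->
  (\dim U < \dim V)%N.
Proof.
move=> UV xV; apply: contraR; rewrite -leqNgt => dVU.
by have /eqP -> : U == V; rewrite // eqEdim UV.
Qed.

Variable e : nat -> 'rV[R]_d.

(** Covers the [n] collisions from time [p] to time [p + n]; the one from [i] to [i.+1] has normal
    [e i.+1], hence the shift. *)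
Definition seg p n : {vspace 'rV[R]_d} := <<[seq e i | i <- iota p.+1 n]>>%VS.

Lemma mem_seg p n i : (p <= i < p + n)%N -> e i.+1 \in seg p n.
Proof.
by move=> /andP [pi ip]; apply/memv_span/map_f; rewrite mem_iota ltnS pi addSn ltnS.
Qed.

Lemma seg_sub p n q m : (q <= p)%N -> (p + n <= q + m)%N ->
  (seg p n <= seg q m)%VS.
Proof.
move=> qp pq; apply/span_subvP => x /mapP [[|i]].
  by rewrite mem_iota ltn0.
rewrite mem_iota ltnS addSn ltnS => /andP [pi ip] ->; apply: mem_seg.
by rewrite (leq_trans qp) // (leq_trans ip).
Qed.

(** Reading forwards, a normal is kept when it is new, so the subpath [seg p j] preceding it has
    smaller rank than [seg p n]. *)
Lemma seg_forward_basis p n : exists t,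
  [/\ free t, <<t>>%VS = seg p n & forall x, x \in t ->
    exists2 j, (j < n)%N & x = e (p + j).+1 /\ x \notin seg p j].
Proof.
elim: n => [|n [t [ft tE tP]]].
  by exists [::]; split=> //; rewrite ?nil_free.
have segS : seg p n.+1 = (<[e (p + n).+1]> + seg p n)%VS.
  by rewrite /seg -[n.+1]addn1 iotaD map_cat span_cat /= span_seq1 addSn addvC.
have [ein|enin] := boolP (e (p + n).+1 \in seg p n).
  exists t; split=> // [|x /tP [j jn]]; last by exists j => //; rewrite ltnS ltnW.
  by rewrite segS tE; apply/esym/addv_idPr; rewrite -memvE.
exists (e (p + n).+1 :: t); split.
- by rewrite free_cons tE enin.
- by rewrite span_cons tE segS.
- move=> x; rewrite inE => /predU1P [->|/tP [j jn]]; first by exists n.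
  by exists j => //; rewrite ltnS ltnW.
Qed.

(** Mirror image: a normal is kept when it is outside the span of those after it. *)
Lemma seg_backward_basis p n : exists t,
  [/\ free t, <<t>>%VS = seg p n & forall x, x \in t ->
    exists2 j, (j < n)%N & x = e (p + j).+1 /\ x \notin seg (p + j).+1 (n - j.+1)].
Proof.
elim: n p => [|n IH] p.
  by exists [::]; split=> //; rewrite ?nil_free.
have [t [ft tE tP]] := IH p.+1.
have segS : seg p n.+1 = (<[e p.+1]> + seg p.+1 n)%VS by rewrite /seg /= span_cons.
have tP' x : x \in t -> exists2 j, (j < n.+1)%N &
    x = e (p + j).+1 /\ x \notin seg (p + j).+1 (n.+1 - j.+1).
  by move=> /tP [j jn]; exists j.+1 => //; rewrite addnS -addSn subSS.
have [ein|enin] := boolP (e p.+1 \in seg p.+1 n).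
  exists t; split=> //.
  by rewrite segS tE; apply/esym/addv_idPr; rewrite -memvE.
exists (e p.+1 :: t); split.
- by rewrite free_cons tE enin.
- by rewrite span_cons tE segS.
- move=> x; rewrite inE => /predU1P [->|/tP' //].
  by exists 0%N => //; rewrite addn0 subSS subn0.
Qed.

(** * Displacement bounds along a path of tangent vectors *)

Variables (N : nat) (kappa mu A s : R) (u v : nat -> 'rV[R]_d).
Hypothesis kappa01 : 0 <= kappa < 1.
Hypothesis mu01 : 0 <= mu < 1.
Hypothesis A0 : 0 <= A.
Hypothesis s0 : 0 <= s.
Hypothesis e1 : forall i, dot (e i) (e i) = 1.
Hypothesis v1 : forall i, enorm (v i) <= 1.
Hypothesis vS : forall i, (i < N)%N -> exists g phi : R,
  [/\ 0 <= phi, phi <= mu & v i.+1 = g *: e i.+1 + phi *: v i].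
Hypothesis uS : forall i, (i < N)%N -> exists a b : R,
  u i.+1 - u i = a *: e i.+1 + b *: v i /\ `|b| <= s.
Hypothesis ue : forall i, (i < N)%N -> `|dot (u i) (e i.+1)| <= A * s.
Hypothesis ue' : forall i, (i < N)%N -> `|dot (u i.+1) (e i.+1)| <= A * s.
Hypothesis spreadN : forall t, free t ->
  (forall x, x \in t -> exists2 i, (i < N)%N & x = e i.+1) -> spread kappa t.

(* Off the span of the normals a collision multiplies the velocity by a factor
   at most mu, so the corresponding displacements of u sum geometrically. *)
Lemma orth_displacement p n z : (p + n <= N)%N ->
  (forall x, x \in seg p n -> dot z x = 0) ->
  `|dot z (u (p + n) - u p)| <= s / (1 - mu) * enorm z.
Proof.
move=> pnN zs; have /andP [m0 m1] := mu01.
have ze i : (p <= i < p + n)%N -> dot z (e i.+1) = 0.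
  by move=> pin; apply: zs; exact: mem_seg.
have zj j : (j <= n)%N -> `|dot z (v (p + j)%N)| <= mu ^+ j * enorm z /\
    `|dot z (u (p + j)%N - u p)| <= s * enorm z * ((1 - mu ^+ j) / (1 - mu)).
  elim: j => [|j IH] jn.
    rewrite addn0 subrr dot0r normr0 expr0 subrr mul0r mulr0 mul1r; split=> //.
    apply: le_trans (cauchy_schwarz _ _) _.
    by rewrite ler_piMr ?enorm_ge0.
  have [vj uj] := IH (ltnW jn).
  have jN : (p + j < N)%N by rewrite (leq_trans _ pnN) // ltn_add2l.
  have zej : dot z (e (p + j).+1) = 0 by rewrite ze // leq_addr ltn_add2l.
  have [g [phi [phi0 phimu vE]]] := vS jN.
  have [a [b [uE bs]]] := uS jN.
  rewrite addnS; split.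
    rewrite vE dotDr !dotZr zej mulr0 add0r normrM (ger0_norm phi0) exprS -mulrA.
    by apply: ler_pM.
  have -> : u (p + j).+1 - u p = (u (p + j).+1 - u (p + j)%N) + (u (p + j)%N - u p).
    by rewrite addrA subrK.
  rewrite uE dotDr (dotDr (a *: _)) !dotZr zej mulr0 add0r.
  apply: le_trans (ler_normD _ _) _; rewrite normrM.
  have step : `|b| * `|dot z (v (p + j)%N)| <= s * (mu ^+ j * enorm z).
    by apply: ler_pM.
  apply: le_trans (lerD step uj) _; rewrite exprS le_eqVlt; apply/orP; left.
  by apply/eqP; field; rewrite subr_eq0 gt_eqF.
have [_ h] := zj n (leqnn n); apply: le_trans h _.
rewrite mulrAC; apply: ler_wpM2r; first exact: enorm_ge0.
apply: ler_wpM2l => //; rewrite ler_piMl ?invr_ge0 ?subr_ge0 ?(ltW m1) //.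
by rewrite gerBl exprn_ge0.
Qed.

(** The constant [C_m] for subpaths of rank at most [m]: one term for each endpoint tested on the
    span, built on the constant of rank [m - 1], and [1 / (1 - mu)] for the part off the span. *)
Fixpoint path_const (m : nat) : R :=
  if m is m'.+1 then
    2 * (d%:R / Num.sqrt (1 - kappa ^+ 2) * (A + path_const m')) + (1 - mu)^-1
  else 0.

Lemma path_const_ge0 m : 0 <= path_const m.
Proof.
elim: m => [|m IH] //=; have /andP [m0 m1] := mu01.
rewrite addr_ge0 ?invr_ge0 ?subr_ge0 ?(ltW m1) // mulr_ge0 //.
by rewrite mulr_ge0 ?addr_ge0 // divr_ge0 ?sqrtr_ge0.
Qed.

(** A basis member [e (p + j).+1] is tested just before its collision, at time [p + j], where [ue]
    applies; going back to [u p] costs a displacement along a subpath of smaller rank, at most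
    [B * s]. *)
Lemma forward_bound (B : R) p n y : (p + n <= N)%N -> 0 <= B ->
  (forall j, (j < n)%N -> (\dim (seg p j) < \dim (seg p n))%N ->
     enorm (u (p + j) - u p) <= B * s) ->
  y \in seg p n ->
  `|dot (u p) y| <=
    d%:R / Num.sqrt (1 - kappa ^+ 2) * ((A + B) * s) * enorm y.
Proof.
move=> pnN B0 IH yE; have [t [ft tE tP]] := seg_forward_basis p n.
apply: (@spread_dot _ _ kappa t) => //.
- by move=> x /tP [j _ [-> _]].
- apply: spreadN => // x /tP [j jn [-> _]]; exists (p + j)%N => //.
  by rewrite (leq_trans _ pnN) // ltn_add2l.
- by rewrite tE.
- by rewrite mulr_ge0 ?addr_ge0.
move=> x /tP [j jn [xE xnot]].
have jN : (p + j < N)%N by rewrite (leq_trans _ pnN) // ltn_add2l.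
have dimj : (\dim (seg p j) < \dim (seg p n))%N.
  apply: ltn_dimv xnot; first by apply: seg_sub; rewrite ?leq_add2l ?(ltnW jn).
  by rewrite xE mem_seg // leq_addr ltn_add2l.
have -> : u p = u (p + j)%N - (u (p + j)%N - u p) by rewrite opprB addrC subrK.
rewrite dotBl mulrDl (le_trans (ler_normB _ _)) // xE lerD ?ue //.
apply: le_trans (cauchy_schwarz _ _) _.
by rewrite {2}/enorm e1 sqrtr1 mulr1 IH.
Qed.

(** Time reversed: a basis member is tested just after its collision, by [ue']. *)
Lemma backward_bound (B : R) p n y : (p + n <= N)%N -> 0 <= B ->
  (forall j, (j < n)%N ->
     (\dim (seg (p + j).+1 (n - j.+1)) < \dim (seg p n))%N ->
     enorm (u (p + n) - u (p + j).+1) <= B * s) ->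
  y \in seg p n ->
  `|dot (u (p + n)) y| <=
    d%:R / Num.sqrt (1 - kappa ^+ 2) * ((A + B) * s) * enorm y.
Proof.
move=> pnN B0 IH yE; have [t [ft tE tP]] := seg_backward_basis p n.
apply: (@spread_dot _ _ kappa t) => //.
- by move=> x /tP [j _ [-> _]].
- apply: spreadN => // x /tP [j jn [-> _]]; exists (p + j)%N => //.
  by rewrite (leq_trans _ pnN) // ltn_add2l.
- by rewrite tE.
- by rewrite mulr_ge0 ?addr_ge0.
move=> x /tP [j jn [xE xnot]].
have jN : (p + j < N)%N by rewrite (leq_trans _ pnN) // ltn_add2l.
have dimj : (\dim (seg (p + j).+1 (n - j.+1)) < \dim (seg p n))%N.
  apply: ltn_dimv xnot; last by rewrite xE mem_seg // leq_addr ltn_add2l.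
  by apply: seg_sub; rewrite ?leqW ?leq_addr // -addnS -addnA subnKC.
have -> : u (p + n)%N = u (p + j).+1 + (u (p + n)%N - u (p + j).+1).
  by rewrite addrC subrK.
rewrite dotDl mulrDl (le_trans (ler_normD _ _)) // xE lerD ?ue' //.
apply: le_trans (cauchy_schwarz _ _) _.
by rewrite {2}/enorm e1 sqrtr1 mulr1 IH.
Qed.

(** Induction on the rank. With the displacement split as [x = y + z] along and off [seg p n],
    [|x|^2 = <u_(p+n), y> - <u_p, y> + <z, x>]; the right side is at most a constant times [s |x|],
    and one factor [|x|] cancels. *)
Lemma path_bound m p n : (p + n <= N)%N -> (\dim (seg p n) <= m)%N ->
  enorm (u (p + n) - u p) <= path_const m * s.
Proof.
elim: m p n => [|m IH] p n pnN dim_le.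
  (* Unit normals are nonzero, so rank 0 means no collision at all. *)
  have -> : n = 0%N.
    apply/eqP; rewrite -leqn0 leqNgt; apply/negP => n0.
    have : e p.+1 \in seg p n by rewrite mem_seg // leqnn -{1}[p]addn0 ltn_add2l.
    have -> : seg p n = 0%VS by apply/eqP; rewrite -dimv_eq0 -leqn0.
    rewrite memv0 => /eqP e0; have := e1 p.+1; rewrite e0 dot0l => /eqP.
    by rewrite eq_sym oner_eq0.
  by rewrite addn0 subrr /enorm dot0l sqrtr0 mul0r.
have [y [z [xE yE zE]]] := orth_decomp (seg p n) (u (p + n)%N - u p).
have yz : dot z y = 0 by exact: zE.
set x := u (p + n)%N - u p in xE *.
have xx : dot x x = dot y y + dot z z by rewrite xE !dotE yz (dotC y) yz; ring.
have B0 := path_const_ge0 m.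
pose K := d%:R / Num.sqrt (1 - kappa ^+ 2).
have fb : `|dot (u p) y| <= K * ((A + path_const m) * s) * enorm y.
  apply: (@forward_bound (path_const m) p n y) => // j jn jd; apply: IH.
    by rewrite (leq_trans _ pnN) // leq_add2l ltnW.
  by rewrite -ltnS (leq_trans jd).
have bb : `|dot (u (p + n)%N) y| <= K * ((A + path_const m) * s) * enorm y.
  apply: (@backward_bound (path_const m) p n y) => // j jn jd.
  have pn : (p + n = (p + j).+1 + (n - j.+1))%N by rewrite -addnS -addnA subnKC.
  by rewrite {1}pn; apply: IH; rewrite -?pn // -ltnS (leq_trans jd).
have := orth_displacement pnN zE; rewrite -/x => zb.
have yx : enorm y <= enorm x by rewrite ler_wsqrtr // xx lerDl dot_ge0.
have zx : enorm z <= enorm x by rewrite ler_wsqrtr // xx lerDr dot_ge0.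
have [->|x0] := eqVneq (enorm x) 0; first by rewrite mulr_ge0 ?path_const_ge0.
have {}x0 : 0 < enorm x by rewrite lt_neqAle eq_sym x0 enorm_ge0.
rewrite -(ler_pM2r x0) -expr2 sqr_enorm.
have -> : dot x x = dot (u (p + n)%N) y - dot (u p) y + dot z x.
  by rewrite -dotBl -/x {2}xE dotDr (dotC z).
rewrite /= -/K.
have K0 : 0 <= K by rewrite divr_ge0 ?sqrtr_ge0.
have /andP [m0 m1] := mu01.
have c1 : K * ((A + path_const m) * s) * enorm y <=
    K * ((A + path_const m) * s) * enorm x.
  by apply: ler_wpM2l yx; rewrite !mulr_ge0 ?addr_ge0.
have c2 : s / (1 - mu) * enorm z <= s / (1 - mu) * enorm x.
  by apply: ler_wpM2l zx; rewrite divr_ge0 // subr_ge0 ltW.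
move: fb bb zb; rewrite !ler_norml => /andP [fb _] /andP [_ bb] /andP [_ zb].
have -> : (2 * (K * (A + path_const m)) + (1 - mu)^-1) * s * enorm x =
   K * ((A + path_const m) * s) * enorm x * 2 + s / (1 - mu) * enorm x by ring.
lra.
Qed.

(** Once the span is the whole space, [u 0] can be tested against itself, and one factor [|u 0|]
    cancels. *)
Lemma spanning_path_bound n : (n <= N)%N -> seg 0 n = fullv ->
  enorm (u 0%N) <=
    d%:R / Num.sqrt (1 - kappa ^+ 2) * (A + path_const d) * s.
Proof.
move=> nN full; set K := d%:R / _.
have K0 : 0 <= K by rewrite divr_ge0 ?sqrtr_ge0.
have : `|dot (u 0%N) (u 0%N)| <= K * ((A + path_const d) * s) * enorm (u 0%N).
  apply: (@forward_bound (path_const d) 0 n) => //.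
  - exact: path_const_ge0.
  - move=> j jn _; apply: path_bound; first by rewrite (leq_trans _ nN) // ltnW.
    by rewrite (leq_trans (dimvS (subvf _))) // dimvf /dim /= mul1n.
  - by rewrite full memvf.
rewrite ger0_norm ?dot_ge0 // -sqr_enorm expr2 mulrA.
have [->|u0] := eqVneq (enorm (u 0%N)) 0.
  by rewrite !mulr_ge0 // addr_ge0 // path_const_ge0.
by rewrite ler_pM2r // lt_neqAle eq_sym u0 enorm_ge0.
Qed.

End TangentPath.

(** * Trajectories and the velocity tangent flow *)

Section Flow.
Context {R : realType} {d : nat}.
Implicit Types (v eta : nat -> 'rV[R]_d) (u : 'rV[R]_d).

Lemma flowS v eta n u :
  flow v eta 0 n.+1 u = flow_step v eta n.+1 (flow v eta 0 n u).
Proof.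
have iotaS : iota 1 n.+1 = iota 1 n ++ [:: n.+1] by have := iotaD 1 n 1; rewrite addn1.
by rewrite /flow /index_iota !subSS !subn0 iotaS foldl_cat.
Qed.

(** For [k = 0] a single normal would span a space of dimension at least 2. Positivity ensures
    [k + 1 <= 2 k]. *)
Lemma generating_gt0 k eta : (2 <= d)%N -> generating k eta -> (0 < k)%N.
Proof.
move=> d2 gen; case: k gen => [gen|//]; have := congr1 (@dimv _ _) (gen 0%N 0%N isT).
rewrite /index_iota /= span_seq1 dim_vline dimvf /dim /= mul1n => dE.
by move: d2; rewrite -dE; case: (_ != 0).
Qed.

(** The spanning hypothesis takes [d] faces at once, so [t] is first completed to a basis by normals
    from the window [[0, k]], which spans. *)
Lemma trajectory_spread (f : R -> R) P (eps kappa : R) k v eta t : (2 <= d)%N ->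
  trajectory f P v eta -> spanning eps P -> generating k eta ->
  (forall x : R, -1 <= x <= 1 -> eps <= acos x -> x <= kappa) ->
  free t -> (forall x, x \in t -> exists i, x = eta i) -> spread kappa t.
Proof.
move=> d2 [tr _] sP gen hk ft tP.
have [t' [t'sub fb full]] := free_extend [seq eta n | n <- index_iota 0 k.+1] ft.
apply: (@spread_sub _ _ _ _ (t' ++ t)).
  by move=> x; rewrite mem_cat orbC => ->.
apply: (normals_spread d2 sP hk fb).
  have bfull : <<t' ++ t>>%VS = fullv.
    by apply/eqP; rewrite eqEsubv subvf -(gen 0%N k).
  by rewrite -(eqP fb) bfull dimvf /dim /= mul1n.
move=> e; rewrite mem_cat => /orP [/t'sub /mapP [n _ ->]|/tP [n ->]];
  by case: (tr n).
Qed.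

Lemma trajectory_step (f : R -> R) P (mu : R) v eta i u :
  (forall t, 0 <= t < pi / 2 -> 0 <= sin (f t) <= mu * sin t) ->
  0 <= mu < 1 -> trajectory f P v eta -> dot (v i) (eta i.+1) != 0 ->
  dot u (v i) = 0 -> let u' := flow_step v eta i.+1 u in
  exists g phi t a b : R,
    [/\ v i.+1 = g *: eta i.+1 + phi *: v i, 0 <= phi <= mu,
      dot u' (v i.+1) = 0 &
      [/\ dot u' u' = dot u u + t ^+ 2 * (1 - phi ^+ 2),
    u' - u = a *: eta i.+1 + b *: v i, b ^+ 2 <= t ^+ 2 * (1 - phi ^+ 2) &
    `|dot u (eta i.+1)| <= `|t| /\ `|dot u' (eta i.+1)| <= `|t| ] ].
Proof.
move=> fmu /andP [m0 m1] [tr trS] c0 uv u'.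
have [le0 vE] := trS i.
have [/usphereP vv _] := tr i.
have [/usphereP vv' [F [/usphereP ee _ _]]] := tr i.+1.
have [|g [phi [phi0 phimu vE']]] := contract_refl fmu m0 ee vv.
  by rewrite lt_neqAle c0.
rewrite -vE in vE'.
have phi1 : 0 <= phi <= 1 by rewrite phi0 (le_trans phimu) // ltW.
rewrite vE' in vv'.
have [t [a [b]]] := flow_step_expand ee vv vv' phi1 c0 uv.
rewrite -vE' => -[h1 h2 h3 h4 h5].
by exists g, phi, t, a, b; split; rewrite ?phi0.
Qed.

End Flow.

(** * Uniform expansion over [2 k] collisions *)

Unset Implicit Arguments.

Theorem theorem5p1 (R : realType) (d : nat) (hd : (2 <= d)%N)
    (eps : R) (heps : 0 < eps)
    (f : R -> R) (hf : contracting_reflection_law f) :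
  exists2 sigma : R, 1 < sigma &
    forall (P : set 'rV[R]_d), is_polytope P -> has_dim P d ->
    forall (v eta : nat -> 'rV[R]_d), trajectory f P v eta ->
    forall k : nat,
      spanning eps P ->
      generating k eta ->
      flow_defined v eta 0 (2 * k) ->
      forall u : 'rV[R]_d, dot u (v 0%N) = 0 ->
        sigma * enorm u <= enorm (flow v eta 0 (2 * k) u).
Proof.
have [mu mu01 fmu] := reflection_law_sin_bound hf.
have [kappa kappa01 hk] := acos_bound heps.
have /andP [m0 m1] := mu01.
have mm : 0 < 1 - mu ^+ 2 by rewrite subr_gt0 expr_lt1.
(* From [t ^+ 2 * (1 - phi ^+ 2) <= s ^+ 2] and [phi <= mu] follows [|t| <= A * s]. *)
pose A := (Num.sqrt (1 - mu ^+ 2))^-1.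
have A0 : 0 <= A by rewrite invr_ge0 sqrtr_ge0.
(* The constant of [spanning_path_bound]; it is fixed by [kappa], [mu] and [d], before the polytope
   and the trajectory are introduced. *)
pose C := d%:R / Num.sqrt (1 - kappa ^+ 2) * (A + path_const (d := d) kappa mu A d).
have C0 : 0 <= C.
  by rewrite mulr_ge0 ?divr_ge0 ?sqrtr_ge0 // addr_ge0 // path_const_ge0.
have C1 : 0 < (C + 1) ^+ 2 by rewrite exprn_gt0 // ltr_wpDl.
(* This solves [|u|^2 <= (C + 1)^2 (|w|^2 - |u|^2)] for [|w|], with [w] the image of [u]; using
   [C + 1] guarantees a positive divisor. *)
exists (Num.sqrt (1 + ((C + 1) ^+ 2)^-1)).
  by rewrite -[ltLHS]sqrtr1 ltr_sqrt ?ltrDl ?invr_gt0 // addr_gt0 ?invr_gt0.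
move=> P _ _ v eta tr k sP gen; set N := (2 * k)%N => fd u uv.
have k0 := generating_gt0 hd gen.
pose w i := flow v eta 0 i u.
have w0 : w 0%N = u by [].
have wS i : w i.+1 = flow_step v eta i.+1 (w i) by exact: flowS.
have nz i : (i < N)%N -> dot (v i) (eta i.+1) != 0 by move=> iN; apply: (fd i.+1).
have wv i : (i <= N)%N -> dot (w i) (v i) = 0.
  elim: i => [//|i IH] iN; rewrite wS.
  by have [g [phi [t [a [b []]]]]] :=
    trajectory_step fmu mu01 tr (nz i iN) (IH (ltnW iN)).
have stepP i (iN : (i < N)%N) :=
  trajectory_step fmu mu01 tr (nz i iN) (wv i (ltnW iN)).
have grow1 i : (i < N)%N -> dot (w i) (w i) <= dot (w i.+1) (w i.+1).
  move=> /stepP [g [phi [t [a [b [_ /andP [p0 pm] _ [h _ _ _]]]]]]].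
  rewrite wS h lerDl mulr_ge0 ?sqr_ge0 // subr_ge0 expr_le1 //.
  by rewrite (le_trans pm) // ltW.
have grow i j : (i <= j)%N -> (j <= N)%N -> dot (w i) (w i) <= dot (w j) (w j).
  elim: j => [|j IH]; first by rewrite leqn0 => /eqP ->.
  rewrite leq_eqVlt => /predU1P [-> //|ij jN].
  by apply: le_trans (grow1 j jN); apply: IH => //; exact: ltnW.
(* The total gain is [s ^+ 2]; by monotonicity of the norm it dominates the gain of each
   collision. *)
pose s := Num.sqrt (dot (w N) (w N) - dot (w 0%N) (w 0%N)).
have s0 : 0 <= s by exact: sqrtr_ge0.
have sE : s ^+ 2 = dot (w N) (w N) - dot (w 0%N) (w 0%N).
  by rewrite sqr_sqrtr // subr_ge0 grow.
have gain i : (i < N)%N -> dot (w i.+1) (w i.+1) - dot (w i) (w i) <= s ^+ 2.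
  by move=> iN; rewrite sE lerB // grow // ltnW.
have stepN i : (i < N)%N -> exists g phi a b : R,
    [/\ v i.+1 = g *: eta i.+1 + phi *: v i, 0 <= phi <= mu,
      w i.+1 - w i = a *: eta i.+1 + b *: v i, `|b| <= s &
      `|dot (w i) (eta i.+1)| <= A * s /\ `|dot (w i.+1) (eta i.+1)| <= A * s].
  move=> iN; have [g [phi [t [a [b [vE pI _ [h wE hb [h1 h2]]]]]]]] := stepP i iN.
  have := gain i iN; rewrite wS h addrAC subrr add0r => tg.
  have tA : `|t| <= A * s.
    rewrite mulrC ler_pdivlMr ?sqrtr_gt0 //.
    rewrite -ler_sqr ?nnegrE ?mulr_ge0 ?sqrtr_ge0 // exprMn sqr_sqrtr ?(ltW mm) //.
    rewrite real_normK ?num_real //; apply: le_trans tg.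
    apply: ler_wpM2l; first exact: sqr_ge0.
    by case/andP: pI => p0 pm; rewrite lerD2l lerN2 ler_sqr ?nnegrE.
  exists g, phi, a, b; split=> //.
  - by rewrite -ler_sqr ?nnegrE // real_normK ?num_real // (le_trans hb).
  - by split; [apply: le_trans h1 tA | apply: le_trans h2 tA].
have uC : enorm (w 0%N) <= C * s.
  (* The first [k + 1] collisions have the normals of the interval [[1, k + 1]], which span by
     [generating]. *)
  apply: (@spanning_path_bound R d eta N kappa mu A s w v) (k.+1) _ _ => //.
  - move=> i; have [_ [F [/usphereP ee _ _]]] := tr.1 i; exact: ee.
  - by move=> i; have [-> _] := tr.1 i.
  - move=> i /stepN [g [phi [a [b [vE /andP [p0 pm] _ _ _]]]]].
    by exists g, phi.
  - by move=> i /stepN [g [phi [a [b [_ _ wE bs _]]]]]; exists a, b.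
  - by move=> i /stepN [g [phi [a [b [_ _ _ _ []]]]]].
  - by move=> i /stepN [g [phi [a [b [_ _ _ _ []]]]]].
  - move=> t ft tP; apply: (trajectory_spread hd tr sP gen hk ft).
    by move=> x /tP [i _ ->]; exists i.+1.
  - by rewrite /N mul2n -addnn -addn1 leq_add2l.
  - by rewrite -(gen 1%N k.+1) // /seg /index_iota subn1.
have u2 : dot u u <= (C + 1) ^+ 2 * (dot (w N) (w N) - dot u u).
  have Cs : 0 <= (C + 1) * s by rewrite mulr_ge0 // addr_ge0.
  rewrite -[u]w0 -sE -exprMn -sqr_enorm ler_sqr ?nnegrE ?enorm_ge0 //.
  by apply: le_trans uC _; rewrite ler_wpM2r // lerDl.
rewrite -ler_sqr ?nnegrE ?mulr_ge0 ?sqrtr_ge0 ?enorm_ge0 // exprMn !sqr_enorm.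
rewrite sqr_sqrtr; last by rewrite addr_ge0 // invr_ge0 ltW.
by rewrite mulrDl mul1r -lerBrDl mulrC ler_pdivrMr // mulrC.
Qed.
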